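(* Let $\mathcal{R}$ be the Reuleaux triangle with vertices $V_1,V_2,V_3$ and let $M$ be a point of the side (arc) $V_1V_2$ of $\mathcal{R}$, $M\neq V_1,V_2$. Let $A_1,A_2,B_1,B_2$ be the endpoints of the two elliptic arcs of the negative pedal curve $\mathcal{N}$ of $\mathcal{R}$ with respect to $M$, and let $P_0$ be the point which is the negative pedal curve of the arc $V_1V_2$. Then the conic $\mathcal{C}^*$ passing through the five points $P_0,A_1,A_2,B_1,B_2$ has one focus at $M$, and its focal axis passes through the circumcenter of $\triangle V_1V_2V_3$.
   Context: Let $V_1V_2V_3$ be an equilateral triangle in the plane with side length $r$. The Reuleaux triangle $\mathcal{R}$ is the closed convex curve formed by three circular arcs (its sides) of radius $r$: the arc $V_iV_j$ has center $V_k$ and is the minor ($60^\circ$) arc from $V_i$ to $V_j$, $\{i,j,k\}=\{1,2,3\}$. Negative pedal curve: for a regular curve parametrized by $\gamma$ and a pedal point $M$, its negative pedal curve is the envelope of the lines $\ell_P$ through points $P=\gamma(t)\ne M$ of the curve and perpendicular to $PM$. The image of $P=\gamma(t)$ is the point $X$ of $\ell_P$ where $\ell_P$ touches the envelope, i.e. the point $X$ with $(X-\gamma(t))\cdot(\gamma(t)-M)=0$ and $\frac{\partial}{\partial t}\big[(X-\gamma(t))\cdot(\gamma(t)-M)\big]=0$. The negative pedal curve $\mathcal{N}$ of $\mathcal{R}$ is the union of the negative pedal curves of its three sides. Here $M$ lies on the arc $V_1V_2$ (centered at $V_3$), and the negative pedal curve of this arc is a single point $P_0$ (the antipode of $M$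 on the circle centered at $V_3$). The negative pedal curves of the arcs $V_1V_3$ and $V_2V_3$ are elliptic arcs $A_1A_2$ and $B_1B_2$ respectively: $A_1$ is the image of $V_1$ and $A_2$ the image of $V_3$, both regarded as points of the arc $V_1V_3$; $B_1$ is the image of $V_2$ and $B_2$ the image of $V_3$, both regarded as points of the arc $V_2V_3$. The focal axis of a conic is the axis of symmetry containing its focus or foci. *)

(* Defs.v *)
From Stdlib Require Import Reals.
From Coquelicot Require Import Coquelicot.
Open Scope R_scope.

Definition point : Type := (R * R)%type.

Definition edist (P Q : point) : R := dist_euc (fst P) (snd P) (fst Q) (snd Q).

Definition padd (P Q : point) : point := (fst P + fst Q, snd P + snd Q).
Definition psub (P Q : point) : point := (fst P - fst Q, snd P - snd Q).
Definition dot (P Q : point) : R := fst P * fst Q + snd P * snd Q.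

Definition equilateral (r : R) (V1 V2 V3 : point) : Prop :=
  0 < r /\ edist V1 V2 = r /\ edist V2 V3 = r /\ edist V3 V1 = r.

Definition is_circumcenter (V1 V2 V3 O : point) : Prop :=
  edist O V1 = edist O V2 /\ edist O V2 = edist O V3.

(** ** Circular arcs *)

Definition circ (K : point) (r : R) (t : R) : point :=
  padd K (r * cos t, r * sin t).

(** [minor_arc K r A B t]: the angle [t] parametrizes, via [circ K r], a point
    of the closed minor arc from [A] to [B] of the circle with center [K] and
    radius [r].  Both orientations of [A], [B] around [K] are covered, and the
    angle is only determined up to a multiple of [2 * PI].  When [K], [A], [B]
    are the vertices of an equilateral triangle of side [r], the arc has
    60 degrees. *)
Definition minor_arc (K : point) (r : R) (A B : point) (t : R) : Prop :=
  exists a b : R,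
    circ K r a = A /\ circ K r b = B /\ Rabs (b - a) < PI /\
    Rmin a b <= t <= Rmax a b.

Definition on_minor_arc (K : point) (r : R) (A B : point) (P : point) : Prop :=
  exists t : R, minor_arc K r A B t /\ circ K r t = P.

(** ** Negative pedal curves of a curve [gamma] restricted to the parameters
    satisfying [dom] *)

(** [X] is the point where the perpendicular at [gamma t] to the line through
    [gamma t] and [M] touches the envelope of these perpendiculars. *)
Definition neg_pedal_touch (gamma : R -> point) (M : point) (t : R) (X : point)
    : Prop :=
  gamma t <> M /\
  dot (psub X (gamma t)) (psub (gamma t) M) = 0 /\
  is_derive (fun s : R => dot (psub X (gamma s)) (psub (gamma s) M)) t 0.

Definition neg_pedal_image (gamma : R -> point) (dom : R -> Prop)
    (M P X : point) : Prop :=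
  exists t : R, dom t /\ gamma t = P /\ neg_pedal_touch gamma M t X.

Definition neg_pedal_curve (gamma : R -> point) (dom : R -> Prop)
    (M X : point) : Prop :=
  exists t : R, dom t /\ neg_pedal_touch gamma M t X.

(** ** Lines *)

(** The line [lp * x + lq * y = ls]. *)
Record line : Type := Line {
  lp : R;
  lq : R;
  ls : R;
  line_nondeg : (lp, lq) <> (0, 0)
}.

Definition line_eval (L : line) (X : point) : R :=
  lp L * fst X + lq L * snd X - ls L.

Definition on_line (L : line) (X : point) : Prop := line_eval L X = 0.

Definition dist_line (L : line) (X : point) : R :=
  Rabs (line_eval L X) / sqrt ((lp L)^2 + (lq L)^2).

(** Orthogonal reflection in the line [L]. *)
Definition reflect (L : line) (X : point) : point :=
  let k := 2 * line_eval L X / ((lp L)^2 + (lq L)^2) in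
  (fst X - k * lp L, snd X - k * lq L).

(** ** Conics, as point sets *)

(** Zero locus of a polynomial of degree exactly 2; degenerate loci are
    allowed. *)
Definition is_conic (S : point -> Prop) : Prop :=
  exists a b c d e f : R,
    ~ (a = 0 /\ b = 0 /\ c = 0) /\
    forall X : point,
      S X <->
      a * (fst X)^2 + b * (fst X * snd X) + c * (snd X)^2
      + d * fst X + e * snd X + f = 0.

(** Either [S] is a circle and [F] its center, or [S] is the locus with focus
    [F], directrix [D] (not through [F]) and eccentricity [e].  In both cases
    [S] is nondegenerate; for [e > 1] the locus consists of both branches of
    the hyperbola. *)
Definition is_focus (S : point -> Prop) (F : point) : Prop :=
  (exists rho : R, 0 < rho /\ forall X : point, S X <-> edist X F = rho) \/
  (exists (D : line) (e : R),
     0 < e /\ ~ on_line D F /\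
     forall X : point, S X <-> edist X F = e * dist_line D X).

Definition is_focal_axis (S : point -> Prop) (L : line) : Prop :=
  (forall X : point, S X <-> S (reflect L X)) /\
  (forall F : point, is_focus S F -> on_line L F).

Definition passes_through5 (S : point -> Prop) (P1 P2 P3 P4 P5 : point) : Prop :=
  S P1 /\ S P2 /\ S P3 /\ S P4 /\ S P5.

(* Main.v *)
Require Import Defs.
From Stdlib Require Import Reals Lra List.
From Coquelicot Require Import Coquelicot.
Import ListNotations.
Open Scope R_scope.

(** The conic is found explicitly.  A locus with focus [M] has the form
    [|X - M|^2 = (c + g . (X - M))^2] ([focal_conic M g c]): the directrix is
    the zero line of the affine form on the right, the eccentricity is [|g|],
    and the focal axis is the line through [M] directed by [g].  The theorem
    amounts to the fact that the five points lie on such a conic with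
    [g = 2 (O - M) / r], where [O] is the circumcenter and [r] the side of the
    triangle.

    To see this, use the oblique frame with origin [M] and basis
    [e1 = V1 - V3], [e2 = V2 - V3].  There [M = V3 + m e1 + n e2] with
    [m, n > 0] and [m^2 + m n + n^2 = 1], which says exactly that [M] is in the
    interior of the arc.  For an arc with center [K], the touching point [X] of
    the perpendicular at [P] is the solution of two linear equations in [X],
    with nonzero determinant [(P - K) . (P - M)]
    ([neg_pedal_touch_unique]).  Solving them makes all the coordinates
    rational in [m] and [n]; in particular [A1] is at distance
    [2 n r / (1 + m + n)] from [M], in the direction of [M - V3] turned by 120
    degrees, and [B1] is similar with the opposite rotation
    ([elliptic_arc_ends]).  Membership of the five points in the conic then
    follows from the relation between [m] and [n], with
    [c = 2 r (m + n - 1)], and [c <> 0] because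
    [(m + n)^2 = 1 + m n > 1].

    The rest holds for every focal conic with [c <> 0] and [g <> 0] that
    contains five distinct points.  No three distinct points of it are collinear, so a quadratic
    polynomial vanishing at five of its points is a multiple of its own
    equation ([five_points_determine]).  This gives uniqueness of the conic,
    and, by comparing coefficients of two focal equations of the same conic,
    that every focus is on the axis ([focal_conic_foci_on_axis]).  Conversely, a
    line through [M] that is an axis of symmetry but is not directed by [g]
    would force the conic into a union of two lines ([focal_axis_direction]).
    The eccentricity may be smaller than, equal to or larger than 1, depending
    on [M]; the argument is uniform in it. *)

(** * Plane vectors *)

Definition cross (P Q : point) : R := fst P * snd Q - snd P * fst Q.

Ltac coords := unfold dot, cross, psub, padd in *; simpl in *.

Lemma point_eq (P Q : point) : fst P = fst Q -> snd P = snd Q -> P = Q.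
Proof. destruct P, Q; simpl; intros -> ->; reflexivity. Qed.

Lemma dot_pos (P : point) : P <> (0, 0) -> 0 < dot P P.
Proof.
  intros HP.
  destruct (Req_dec (fst P) 0) as [Hx|Hx].
  - assert (Hy : snd P <> 0) by (intros Hy; apply HP; apply point_eq; assumption).
    pose proof (Rle_0_sqr (fst P)). pose proof (Rsqr_pos_lt _ Hy).
    unfold Rsqr, dot in *; lra.
  - pose proof (Rle_0_sqr (snd P)). pose proof (Rsqr_pos_lt _ Hx).
    unfold Rsqr, dot in *; lra.
Qed.

Lemma dot_psub_pos (P Q : point) : P <> Q -> 0 < dot (psub Q P) (psub Q P).
Proof.
  intros HPQ; apply dot_pos; intros H; apply HPQ.
  injection H; intros; apply point_eq; lra.
Qed.

Lemma edist_sqr (P Q : point) : edist P Q ^ 2 = dot (psub P Q) (psub P Q).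
Proof.
  unfold edist, dist_euc. rewrite pow2_sqrt.
  - coords. unfold Rsqr. ring.
  - apply Rplus_le_le_0_compat; apply Rle_0_sqr.
Qed.

Lemma edist_nonneg (P Q : point) : 0 <= edist P Q.
Proof. apply sqrt_pos. Qed.

Definition midpoint (P Q : point) : point :=
  ((fst P + fst Q) / 2, (snd P + snd Q) / 2).

Lemma affine_form_zero (l1 l2 l0 : R) (P Q S : point) :
  cross (psub Q P) (psub S P) <> 0 ->
  l1 * fst P + l2 * snd P + l0 = 0 ->
  l1 * fst Q + l2 * snd Q + l0 = 0 ->
  l1 * fst S + l2 * snd S + l0 = 0 ->
  l1 = 0 /\ l2 = 0 /\ l0 = 0.
Proof.
  intros Hc HP HQ HS. coords.
  assert (EQ : l1 * (fst Q - fst P) + l2 * (snd Q - snd P) = 0) by lra.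
  assert (ES : l1 * (fst S - fst P) + l2 * (snd S - snd P) = 0) by lra.
  set (D := _ - _) in Hc.
  assert (H1 : l1 * D = 0).
  { transitivity (0 * (snd S - snd P) - 0 * (snd Q - snd P)); [|ring].
    rewrite <- EQ at 1; rewrite <- ES; unfold D; ring. }
  assert (H2 : l2 * D = 0).
  { transitivity (0 * (fst Q - fst P) - 0 * (fst S - fst P)); [|ring].
    rewrite <- ES at 1; rewrite <- EQ; unfold D; ring. }
  apply Rmult_integral in H1, H2.
  assert (l1 = 0) by tauto. assert (l2 = 0) by tauto. subst.
  repeat split; lra.
Qed.

Definition line_normal (L : line) : point := (lp L, lq L).

Lemma line_normal_pos (L : line) : 0 < dot (line_normal L) (line_normal L).
Proof. apply dot_pos, line_nondeg. Qed.

Lemma line_eval_from (L : line) (M X : point) :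
  on_line L M -> line_eval L X = dot (line_normal L) (psub X M).
Proof. unfold on_line, line_eval, line_normal. intros H; coords; lra. Qed.

Lemma on_line_collinear (L : line) (P Q S : point) :
  on_line L P -> on_line L Q -> on_line L S -> cross (psub Q P) (psub S P) = 0.
Proof.
  destruct L as [p q s Hn]. unfold on_line, line_eval; simpl; intros HP HQ HS.
  destruct (Req_dec (cross (psub Q P) (psub S P)) 0) as [H|H]; [exact H|exfalso].
  destruct (affine_form_zero p q (- s) P Q S) as (-> & -> & _); try lra.
  apply Hn; reflexivity.
Qed.

(** * Quadratic polynomials vanishing on a line *)

Definition is_quadratic (Q : point -> R) : Prop :=
  exists a b c d e f : R, forall X : point,
    Q X = a * (fst X)^2 + b * (fst X * snd X) + c * (snd X)^2
          + d * fst X + e * snd X + f.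

Lemma is_quadratic_combine (Q Q' : point -> R) (k : R) :
  is_quadratic Q -> is_quadratic Q' -> is_quadratic (fun X => Q X - k * Q' X).
Proof.
  intros (a & b & c & d & e & f & H) (a' & b' & c' & d' & e' & f' & H').
  exists (a - k * a'), (b - k * b'), (c - k * c'),
    (d - k * d'), (e - k * e'), (f - k * f').
  intros X; rewrite H, H'; ring.
Qed.

(** Three zeros on a line force a quadratic to vanish on the whole line, so the
    linear equation of the line divides it.  The third zero is taken at the
    midpoint of the other two. *)
Lemma quadratic_line_factor (Q : point -> R) (P1 P2 : point) :
  is_quadratic Q -> P1 <> P2 ->
  Q P1 = 0 -> Q P2 = 0 -> Q (midpoint P1 P2) = 0 ->
  exists l1 l2 l0 : R, forall X : point,
    Q X = cross (psub P2 P1) (psub X P1) * (l1 * fst X + l2 * snd X + l0).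
Proof.
  intros (a & b & c & d & e & f & HQ) Hne H1 H2 Hm.
  pose proof (dot_psub_pos _ _ Hne) as HN.
  rewrite HQ in H1, H2, Hm. unfold midpoint in Hm.
  destruct P1 as [x1 y1], P2 as [x2 y2]. coords.
  set (u := x2 - x1) in *. set (v := y2 - y1) in *.
  assert (Ex : x2 = x1 + u) by (unfold u; ring).
  assert (Ey : y2 = y1 + v) by (unfold v; ring).
  clearbody u v. subst x2 y2.
  (* [D] and [E] are the linear coefficients after moving the origin to [P1];
     on the line, [Q] is then a quadratic in one variable with three zeros. *)
  set (D := 2 * a * x1 + b * y1 + d).
  set (E := b * x1 + 2 * c * y1 + e).
  assert (Hq : a * u^2 + b * (u * v) + c * v^2 = 0) by (unfold D, E in *; nra).
  assert (Hl : D * u + E * v = 0) by (unfold D, E in *; nra).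
  (* [s] and [t] below are the coordinates of [X - P1] in the basis
     [(u, v), (- v, u)]; the remaining terms of [Q] are all divisible by [t]. *)
  set (N := u * u + v * v) in *.
  set (p := 2 * (- a * u * v + c * u * v) + b * (u^2 - v^2)).
  set (q := a * v^2 - b * u * v + c * u^2).
  set (k := E * u - D * v).
  exists ((p * u - q * v) / N^2), ((p * v + q * u) / N^2),
    (k / N - ((p * u - q * v) * x1 + (p * v + q * u) * y1) / N^2).
  intros [x y]. rewrite HQ; simpl.
  set (s := ((x - x1) * u + (y - y1) * v) / N).
  set (t := (u * (y - y1) - v * (x - x1)) / N).
  assert (Hx : x = x1 + s * u - t * v) by (unfold s, t, N; field; fold N; lra).
  assert (Hy : y = y1 + s * v + t * u) by (unfold s, t, N; field; fold N; lra).
  replace (u * (y - y1) - v * (x - x1)) with (t * N) by (unfold t; field; lra).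
  transitivity (t * (s * p + t * q + k)).
  2: { rewrite Hx, Hy. unfold N. field. fold N. lra. }
  rewrite Hx, Hy.
  transitivity ((a * (x1 * (x1 * 1)) + b * (x1 * y1) + c * (y1 * (y1 * 1))
     + d * x1 + e * y1 + f)
    + s * (D * u + E * v) + s^2 * (a * u^2 + b * (u * v) + c * v^2)
    + t * (s * p + t * q + k)).
  - unfold p, q, k, D, E; ring.
  - rewrite Hq, Hl, H1. ring.
Qed.

(** * Conics given by a focus and an affine form *)

(** For [g <> (0, 0)] and [c <> 0] the zero set is the locus with focus [M],
    eccentricity [|g|] and directrix [c + g . (X - M) = 0].  Squaring both sides
    of the focal equation gives both branches when [|g| > 1]. *)
Definition focal_eval (M g : point) (c : R) (X : point) : R :=
  dot (psub X M) (psub X M) - (c + dot g (psub X M))^2.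

Definition focal_conic (M g : point) (c : R) (X : point) : Prop :=
  focal_eval M g c X = 0.

Lemma focal_eval_expand (M g : point) (c : R) (X : point) :
  let k := c - dot g M in
  focal_eval M g c X =
    (1 - fst g ^ 2) * (fst X)^2 + - (2 * fst g * snd g) * (fst X * snd X)
    + (1 - snd g ^ 2) * (snd X)^2
    + (- 2 * fst M - 2 * k * fst g) * fst X
    + (- 2 * snd M - 2 * k * snd g) * snd X
    + (dot M M - k ^ 2).
Proof. unfold focal_eval; coords; ring. Qed.

Lemma focal_eval_quadratic (M g : point) (c : R) :
  is_quadratic (focal_eval M g c).
Proof. do 6 eexists; apply focal_eval_expand. Qed.

Lemma focal_conic_is_conic (M g : point) (c : R) : is_conic (focal_conic M g c).
Proof.
  do 6 eexists. split.
  2: { intros X. unfold focal_conic. rewrite focal_eval_expand. reflexivity. }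
  (* Both components of [g] would have square 1, and their product would be 0. *)
  intros (H1 & H2 & H3).
  assert (fst g ^ 2 * snd g ^ 2 = 0) by nra. nra.
Qed.

(** A line with three points of the conic is contained in it.  With
    [v = P - M] and [d] the direction of the line, comparing coefficients gives
    equality in Cauchy-Schwarz for [v] and [d], so that the line passes through
    [M]; but the focal equation at [M] reads [c^2 = 0]. *)
Lemma focal_conic_no_three_collinear (M g : point) (c : R) (P Q S : point) :
  c <> 0 ->
  focal_conic M g c P -> focal_conic M g c Q -> focal_conic M g c S ->
  P <> Q -> P <> S -> Q <> S ->
  cross (psub Q P) (psub S P) <> 0.
Proof.
  intros Hc HP HQ HS HPQ HPS HQS Hcol.
  pose proof (dot_psub_pos _ _ HPQ) as HN.
  unfold focal_conic, focal_eval in *.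
  destruct M as [m1 m2], g as [g1 g2], P as [p1 p2], Q as [q1 q2], S as [s1 s2].
  coords.
  set (d1 := q1 - p1) in *. set (d2 := q2 - p2) in *.
  set (v1 := p1 - m1) in *. set (v2 := p2 - m2) in *.
  assert (E1 : q1 - m1 = v1 + d1) by (unfold v1, d1; ring).
  assert (E2 : q2 - m2 = v2 + d2) by (unfold v2, d2; ring).
  rewrite E1, E2 in HQ.
  set (N := d1 * d1 + d2 * d2) in *.
  set (s := ((s1 - p1) * d1 + (s2 - p2) * d2) / N).
  assert (F1 : s1 = p1 + s * d1).
  { transitivity (p1 + s * d1 - d2 * (d1 * (s2 - p2) - d2 * (s1 - p1)) / N).
    - unfold s, N; field; fold N; lra.
    - rewrite Hcol; field; lra. }
  assert (F2 : s2 = p2 + s * d2).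
  { transitivity (p2 + s * d2 + d1 * (d1 * (s2 - p2) - d2 * (s1 - p1)) / N).
    - unfold s, N; field; fold N; lra.
    - rewrite Hcol; field; lra. }
  assert (Hs0 : s <> 0).
  { intros H; apply HPS; rewrite F1, F2, H; apply point_eq; simpl; ring. }
  assert (Hs1 : s <> 1).
  { intros H; apply HQS; rewrite F1, F2, H. apply point_eq; unfold d1, d2; simpl; ring. }
  assert (G1 : s1 - m1 = v1 + s * d1) by (rewrite F1; unfold v1; ring).
  assert (G2 : s2 - m2 = v2 + s * d2) by (rewrite F2; unfold v2; ring).
  rewrite G1, G2 in HS.
  clearbody s d1 d2 v1 v2.
  set (w := c + (g1 * v1 + g2 * v2)) in *.
  set (h := g1 * d1 + g2 * d2).
  (* [2 k C1 + k^2 C2] is the value of the focal equation at [P + k d]. *)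
  set (C1 := v1 * d1 + v2 * d2 - w * h).
  set (C2 := N - h^2).
  assert (H1 : 2 * C1 + C2 = 0) by (unfold C1, C2, N, h, w in *; lra).
  assert (H2 : 2 * s * C1 + s^2 * C2 = 0) by (unfold C1, C2, N, h, w in *; lra).
  assert (H3 : C2 * (s * (s - 1)) = 0) by nra.
  assert (HC2 : C2 = 0).
  { apply Rmult_integral in H3. destruct H3 as [H3|H3]; [exact H3|exfalso].
    apply Rmult_integral in H3. destruct H3; [tauto|apply Hs1; lra]. }
  assert (HC1 : C1 = 0) by lra.
  assert (HV : v1 * v1 + v2 * v2 = w^2) by (simpl; lra).
  (* Now [v . d = w h], [d . d = h^2] and [v . v = w^2]: equality in the
     Cauchy-Schwarz inequality. *)
  assert (Hcr : (v1 * d2 - v2 * d1)^2 = 0).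
  { transitivity ((v1 * v1 + v2 * v2) * N - (v1 * d1 + v2 * d2)^2).
    - unfold N; ring.
    - rewrite HV. replace N with (h^2) by (unfold C2 in HC2; lra).
      replace (v1 * d1 + v2 * d2) with (w * h) by (unfold C1 in HC1; lra). ring. }
  assert (Hcr' : v1 * d2 - v2 * d1 = 0) by nra.
  set (k := (v1 * d1 + v2 * d2) / N).
  assert (K1 : v1 = k * d1).
  { transitivity (k * d1 + d2 * (v1 * d2 - v2 * d1) / N).
    - unfold k, N; field; fold N; lra.
    - rewrite Hcr'; field; lra. }
  assert (K2 : v2 = k * d2).
  { transitivity (k * d2 - d1 * (v1 * d2 - v2 * d1) / N).
    - unfold k, N; field; fold N; lra.
    - rewrite Hcr'; field; lra. }
  assert (L1 : k * N = w * h) by (unfold C1 in HC1; rewrite K1, K2 in HC1; unfold N; lra).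
  assert (L2 : N = h^2) by (unfold C2 in HC2; lra).
  assert (Hh : h <> 0) by (intros H; rewrite H in L2; lra).
  assert (L3 : h * (k * h - w) = 0) by (rewrite L2 in L1; lra).
  apply Rmult_integral in L3. destruct L3 as [L3|L3]; [tauto|].
  apply Hc. unfold w in L3. rewrite K1, K2 in L3. unfold h in L3. lra.
Qed.

Lemma NoDup_five (T : Type) (P1 P2 P3 P4 P5 : T) :
  NoDup [P1; P2; P3; P4; P5] ->
  P1 <> P2 /\ P1 <> P3 /\ P1 <> P4 /\ P1 <> P5 /\ P2 <> P3 /\
  P2 <> P4 /\ P2 <> P5 /\ P3 <> P4 /\ P3 <> P5 /\ P4 <> P5.
Proof.
  intros H. repeat rewrite NoDup_cons_iff in H. simpl in H.
  intuition congruence.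
Qed.

(** Five points, no three collinear, impose independent conditions on
    quadratic polynomials. *)
Lemma five_points_determine (M g : point) (c : R) (P1 P2 P3 P4 P5 : point)
    (Q : point -> R) :
  c <> 0 -> NoDup [P1; P2; P3; P4; P5] ->
  passes_through5 (focal_conic M g c) P1 P2 P3 P4 P5 ->
  is_quadratic Q -> passes_through5 (fun X => Q X = 0) P1 P2 P3 P4 P5 ->
  exists mu : R, forall X : point, Q X = mu * focal_eval M g c X.
Proof.
  intros Hc Hnd (F1 & F2 & F3 & F4 & F5) HQ (Q1 & Q2 & Q3 & Q4 & Q5).
  destruct (NoDup_five _ _ _ _ _ _ Hnd)
    as (N12 & N13 & N14 & N15 & N23 & N24 & N25 & N34 & N35 & N45).
  set (E := midpoint P1 P2).
  assert (HE : focal_eval M g c E <> 0).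
  { intros H.
    apply (focal_conic_no_three_collinear M g c P1 P2 E Hc F1 F2 H N12).
    - intros H'; apply N12. unfold E, midpoint in H'. destruct P1, P2; simpl in *.
      injection H'; intros; apply point_eq; simpl; lra.
    - intros H'; apply N12. unfold E, midpoint in H'. destruct P1, P2; simpl in *.
      injection H'; intros; apply point_eq; simpl; lra.
    - unfold E, midpoint; coords; field. }
  (* This choice of [mu] gives [Q - mu * focal_eval] a third zero on the line
     [P1 P2]; the cofactor of that line then vanishes at [P3], [P4], [P5]. *)
  set (mu := Q E / focal_eval M g c E).
  exists mu.
  destruct (quadratic_line_factor (fun X => Q X - mu * focal_eval M g c X) P1 P2)
    as (l1 & l2 & l0 & Hl); auto.
  - apply is_quadratic_combine; [assumption|apply focal_eval_quadratic].
  - rewrite Q1, F1; ring.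
  - rewrite Q2, F2; ring.
  - fold E; unfold mu; field; assumption.
  - assert (Hoff : forall P, P1 <> P -> P2 <> P -> Q P = 0 -> focal_conic M g c P ->
        l1 * fst P + l2 * snd P + l0 = 0).
    { intros P N1 N2 QP FP. specialize (Hl P). simpl in Hl. rewrite QP, FP in Hl.
      assert (Hx := focal_conic_no_three_collinear M g c P1 P2 P Hc F1 F2 FP N12 N1 N2).
      symmetry in Hl. replace (0 - mu * 0) with 0 in Hl by ring.
      apply Rmult_integral in Hl. tauto. }
    destruct (affine_form_zero l1 l2 l0 P3 P4 P5) as (-> & -> & ->); auto.
    + apply (focal_conic_no_three_collinear M g c); assumption.
    + intros X. specialize (Hl X). simpl in Hl. lra.
Qed.

Lemma five_points_unique_conic (M g : point) (c : R) (P1 P2 P3 P4 P5 : point)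
    (S : point -> Prop) :
  c <> 0 -> NoDup [P1; P2; P3; P4; P5] ->
  passes_through5 (focal_conic M g c) P1 P2 P3 P4 P5 ->
  is_conic S -> passes_through5 S P1 P2 P3 P4 P5 ->
  forall X, S X <-> focal_conic M g c X.
Proof.
  intros Hc Hnd HF (a & b & c' & d & e & f & Hnz & HS) (S1 & S2 & S3 & S4 & S5).
  set (Q := fun X : point => a * (fst X)^2 + b * (fst X * snd X) + c' * (snd X)^2
      + d * fst X + e * snd X + f).
  destruct (five_points_determine M g c P1 P2 P3 P4 P5 Q) as (mu & Hmu); auto.
  - exists a, b, c', d, e, f; reflexivity.
  - unfold Q, passes_through5; repeat split; apply HS; assumption.
  - assert (Hmu0 : mu <> 0).
    { intros ->. apply Hnz.
      assert (HQ0 : forall X, Q X = 0) by (intros X; rewrite Hmu; ring).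
      unfold Q in HQ0.
      pose proof (HQ0 (0, 0)); pose proof (HQ0 (1, 0)); pose proof (HQ0 (-1, 0));
      pose proof (HQ0 (0, 1)); pose proof (HQ0 (0, -1)); pose proof (HQ0 (1, 1));
      simpl in *; repeat split; lra. }
    intros X. rewrite HS. fold (Q X). rewrite Hmu. unfold focal_conic.
    split; intros H.
    + apply Rmult_integral in H; tauto.
    + rewrite H; ring.
Qed.

(** Of five points on two lines, three are on the same line. *)
Lemma focal_conic_not_in_two_lines (M g : point) (c : R) (P1 P2 P3 P4 P5 : point)
    (L L' : line) :
  c <> 0 -> NoDup [P1; P2; P3; P4; P5] ->
  passes_through5 (focal_conic M g c) P1 P2 P3 P4 P5 ->
  ~ (forall X, focal_conic M g c X -> on_line L X \/ on_line L' X).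
Proof.
  intros Hc Hnd (F1 & F2 & F3 & F4 & F5) HL.
  destruct (NoDup_five _ _ _ _ _ _ Hnd)
    as (N12 & N13 & N14 & N15 & N23 & N24 & N25 & N34 & N35 & N45).
  assert (Three : forall (K : line) P Q S, on_line K P -> on_line K Q -> on_line K S ->
     focal_conic M g c P -> focal_conic M g c Q -> focal_conic M g c S ->
     P <> Q -> P <> S -> Q <> S -> False).
  { intros K P Q S KP KQ KS FP FQ FS NPQ NPS NQS.
    apply (focal_conic_no_three_collinear M g c P Q S); auto.
    apply (on_line_collinear K); assumption. }
  destruct (HL _ F1), (HL _ F2), (HL _ F3), (HL _ F4), (HL _ F5);
  match goal with
  | H1 : on_line ?K ?P, H2 : on_line ?K ?Q, H3 : on_line ?K ?S,
    N1 : ?P <> ?Q, N2 : ?P <> ?S, N3 : ?Q <> ?S |- _ =>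
      apply (Three K P Q S); assumption
  end.
Qed.

(** * Foci and focal axes *)

Lemma focal_conic_focus (M g : point) (c : R) :
  c <> 0 -> g <> (0, 0) -> is_focus (focal_conic M g c) M.
Proof.
  intros Hc Hg. right.
  pose proof (dot_pos g Hg) as HG.
  exists (Line (fst g) (snd g) (dot g M - c)
            (fun H => Hg (eq_trans (surjective_pairing g) H))), (sqrt (dot g g)).
  assert (Hr : 0 < sqrt (dot g g)) by (apply sqrt_lt_R0; exact HG).
  split; [exact Hr|split].
  - unfold on_line, line_eval; coords; intros H; apply Hc; lra.
  - intros X. unfold dist_line, line_eval; cbn [lp lq ls].
    replace (fst g ^ 2 + snd g ^ 2) with (dot g g) by (unfold dot; ring).
    replace (fst g * fst X + snd g * snd X - (dot g M - c))
      with (c + dot g (psub X M)) by (coords; ring).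
    replace (sqrt (dot g g) * (_ / _)) with (Rabs (c + dot g (psub X M)))
      by (field; lra).
    unfold focal_conic, focal_eval. rewrite <- edist_sqr.
    rewrite <- (pow2_abs (c + _)).
    pose proof (edist_nonneg X M) as H1.
    pose proof (Rabs_pos (c + dot g (psub X M))) as H2.
    split; intros H; nra.
Qed.

(** Circles are covered by [g = (0, 0)]. *)
Lemma is_focus_focal_eval (S : point -> Prop) (F : point) :
  is_focus S F ->
  exists (g : point) (c : R), forall X, S X -> focal_eval F g c X = 0.
Proof.
  intros [(rho & Hrho & HS)|(D & e & He & HD & HS)].
  - exists (0, 0), rho. intros X HX. apply HS in HX.
    unfold focal_eval. rewrite <- edist_sqr, HX. coords; ring.
  - pose proof (line_normal_pos D) as HN.
    set (w := sqrt (lp D ^ 2 + lq D ^ 2)).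
    assert (Hw : 0 < w).
    { apply sqrt_lt_R0. unfold line_normal in HN; coords; lra. }
    exists (e * lp D / w, e * lq D / w), (e * line_eval D F / w).
    intros X HX. apply HS in HX. unfold dist_line in HX. fold w in HX.
    unfold focal_eval. rewrite <- edist_sqr, HX.
    replace ((e * (Rabs (line_eval D X) / w))^2)
      with (e^2 * (Rabs (line_eval D X))^2 / w^2) by (field; lra).
    rewrite pow2_abs. unfold line_eval; coords. field. lra.
Qed.

(** A second focus [F] gives a second focal equation, with affine form
    [k + g' . (X - M)], proportional to the first with a factor [mu].  The
    quadratic parts show that [g'] is parallel or orthogonal to [g].  If
    parallel, the linear parts put [F] on the axis; if orthogonal,
    then [mu < 0], while the linear and constant parts force
    [k^2 = mu * c^2]. *)
Lemma focal_conic_foci_on_axis (M g : point) (c : R) (P1 P2 P3 P4 P5 F : point) :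
  c <> 0 -> g <> (0, 0) -> NoDup [P1; P2; P3; P4; P5] ->
  passes_through5 (focal_conic M g c) P1 P2 P3 P4 P5 ->
  is_focus (focal_conic M g c) F -> cross g (psub F M) = 0.
Proof.
  intros Hc Hg Hnd HF Hfoc.
  destruct (is_focus_focal_eval _ _ Hfoc) as (g' & c' & Hg').
  destruct (five_points_determine M g c P1 P2 P3 P4 P5 (focal_eval F g' c'))
    as (mu & Hmu); auto.
  { apply focal_eval_quadratic. }
  { destruct HF as (F1 & F2 & F3 & F4 & F5).
    repeat split; apply Hg'; assumption. }
  assert (HG : 0 < dot g g) by (apply dot_pos, Hg).
  destruct M as [m1 m2], g as [g1 g2], F as [f1 f2], g' as [h1 h2].
  unfold focal_eval in Hmu. coords.
  set (k := c' + h1 * (m1 - f1) + h2 * (m2 - f2)).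
  set (u := f1 - m1). set (v := f2 - m2).
  assert (Hq : forall x y,
    (x - u)^2 + (y - v)^2 - (k + h1 * x + h2 * y)^2
    = mu * (x^2 + y^2 - (c + g1 * x + g2 * y)^2)).
  { intros x y. specialize (Hmu (m1 + x, m2 + y)). simpl in Hmu.
    unfold k, u, v.
    match type of Hmu with ?l = ?r => transitivity l; [ring|rewrite Hmu; ring] end. }
  clearbody u v k. clear Hmu Hg' HF Hfoc.
  pose proof (Hq 0 0) as Q00. pose proof (Hq 1 0) as Q10. pose proof (Hq (-1) 0) as Q10'.
  pose proof (Hq 0 1) as Q01. pose proof (Hq 0 (-1)) as Q01'. pose proof (Hq 1 1) as Q11.
  clear Hq.
  assert (Exx : 1 - h1^2 = mu * (1 - g1^2)) by lra.
  assert (Eyy : 1 - h2^2 = mu * (1 - g2^2)) by lra.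
  assert (Exy : h1 * h2 = mu * (g1 * g2)) by lra.
  assert (Ex : u + k * h1 = mu * (c * g1)) by lra.
  assert (Ey : v + k * h2 = mu * (c * g2)) by lra.
  assert (E0 : u^2 + v^2 - k^2 = - mu * c^2) by lra.
  clear Q00 Q10 Q10' Q01 Q01' Q11.
  (* [a] and [b] are the components of [g'] along [g] and across it. *)
  set (G := g1 * g1 + g2 * g2) in *.
  set (a := h1 * g1 + h2 * g2). set (b := g1 * h2 - g2 * h1).
  assert (Hab : a * b = 0).
  { transitivity ((g1^2 - g2^2) * (h1 * h2) + g1 * g2 * (h2^2 - h1^2)).
    - unfold a, b; ring.
    - rewrite Exy. replace (h2^2 - h1^2) with (mu * (g2^2 - g1^2)) by lra. ring. }
  assert (Hbb : G - b^2 = mu * G).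
  { transitivity (g1^2 * (1 - h2^2) + g2^2 * (1 - h1^2) + 2 * g1 * g2 * (h1 * h2)).
    - unfold G, b; ring.
    - rewrite Exx, Eyy, Exy; unfold G; ring. }
  assert (Haa : G - a^2 = mu * (G - G^2)).
  { transitivity (g1^2 * (1 - h1^2) + g2^2 * (1 - h2^2) - 2 * g1 * g2 * (h1 * h2)).
    - unfold G, a; ring.
    - rewrite Exx, Eyy, Exy; unfold G; ring. }
  assert (Hcr : g1 * v - g2 * u + k * b = 0).
  { transitivity (g1 * (v + k * h2) - g2 * (u + k * h1)).
    - unfold b; ring.
    - rewrite Ex, Ey; ring. }
  assert (Hdt : g1 * u + g2 * v + k * a = mu * c * G).
  { transitivity (g1 * (u + k * h1) + g2 * (v + k * h2)).
    - unfold a; ring.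
    - rewrite Ex, Ey; unfold G; ring. }
  apply Rmult_integral in Hab.
  destruct (Req_dec b 0) as [Hb|Hb].
  { rewrite Hb in Hcr. lra. }
  exfalso. assert (Ha : a = 0) by tauto.
  assert (Hb2 : 0 < b^2) by nra.
  assert (Hmu1 : mu * (1 - G) = 1).
  { apply (Rmult_eq_reg_l G); [|lra]. rewrite Ha in Haa. lra. }
  assert (Hmu2 : mu < 1) by nra.
  assert (Hneg : mu < 0).
  { destruct (Rle_or_lt 0 mu) as [H|H]; [|exact H]. nra. }
  rewrite Ha in Hdt.
  (* [F] would be a focus on the conjugate axis of a hyperbola.  Eliminating
     [u] and [v] leaves [k^2 = mu * c^2], with a negative right-hand side. *)
  assert (Hw : k^2 - mu * c^2 = mu^2 * c^2 * G + k^2 * (1 - mu)).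
  { apply (Rmult_eq_reg_l G); [|lra].
    transitivity ((g1 * u + g2 * v)^2 + (g1 * v - g2 * u)^2).
    - replace (k^2 - mu * c^2) with (u^2 + v^2) by lra. unfold G; ring.
    - replace (g1 * u + g2 * v) with (mu * c * G) by lra.
      replace (g1 * v - g2 * u) with (- (k * b)) by lra.
      transitivity (mu^2 * c^2 * G^2 + k^2 * b^2); [ring|].
      replace (b^2) with (G - mu * G) by lra. ring. }
  assert (Hk : mu * (k^2 - mu * c^2) = 0).
  { replace (mu^2 * c^2 * G) with (mu * c^2 * (mu * G)) in Hw by ring.
    replace (mu * G) with (mu - 1) in Hw by lra. lra. }
  apply Rmult_integral in Hk. destruct Hk as [Hk|Hk]; [lra|].
  assert (0 < c^2) by nra. nra.
Qed.

(** Reflection in a line through [M] preserves [|X - M|], so it changes the focal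
    equation only through the affine form. *)
Lemma reflect_focal_eval (M g : point) (c : R) (L : line) (X : point) :
  on_line L M ->
  let n := line_normal L in
  dot n n ^ 2 * (focal_eval M g c X - focal_eval M g c (reflect L X))
  = 4 * (dot n g * (line_eval L X
      * (dot n (psub X M) * dot n g - dot n n * (c + dot g (psub X M))))).
Proof.
  intros HM n. pose proof (line_normal_pos L) as HN. fold n in HN.
  rewrite (line_eval_from L M X HM). fold n.
  unfold focal_eval, reflect. rewrite (line_eval_from L M X HM). fold n.
  unfold n, line_normal in *. coords. field. lra.
Qed.

(** If [n . g <> 0], the difference of the focal equations at [X] and at its
    mirror image factors, and each point of the conic is on [L] or on the line
    where the second factor vanishes. *)
Lemma focal_axis_direction (M g : point) (c : R) (P1 P2 P3 P4 P5 : point) (L : line) :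
  c <> 0 -> NoDup [P1; P2; P3; P4; P5] ->
  passes_through5 (focal_conic M g c) P1 P2 P3 P4 P5 ->
  on_line L M ->
  (forall X, focal_conic M g c X <-> focal_conic M g c (reflect L X)) ->
  dot (line_normal L) g = 0.
Proof.
  intros Hc Hnd HF HM Hsym.
  set (n := line_normal L).
  destruct (Req_dec (dot n g) 0) as [H0|H0]; [exact H0|exfalso].
  set (N := dot n n).
  assert (HN : 0 < N) by apply line_normal_pos.
  set (p' := N * fst g - dot n g * fst n). set (q' := N * snd g - dot n g * snd n).
  set (s' := p' * fst M + q' * snd M - N * c).
  assert (Hcase : forall X, focal_conic M g c X ->
     on_line L X \/ p' * fst X + q' * snd X - s' = 0).
  { intros X HX. pose proof (reflect_focal_eval M g c L X HM) as H.
    cbv zeta in H. fold n N in H.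
    rewrite HX in H. apply Hsym in HX. rewrite HX in H.
    assert (H' : dot n g * (line_eval L X
      * (dot n (psub X M) * dot n g - N * (c + dot g (psub X M)))) = 0) by lra.
    apply Rmult_integral in H'. destruct H' as [H'|H']; [tauto|].
    apply Rmult_integral in H'. destruct H' as [H'|H']; [left; exact H'|right].
    transitivity (- (dot n (psub X M) * dot n g - N * (c + dot g (psub X M)))).
    - unfold s', p', q'. clearbody n N. coords. ring.
    - rewrite H'; ring. }
  destruct (Req_dec p' 0) as [Hp|Hp]; [destruct (Req_dec q' 0) as [Hq|Hq]|].
  (* If the second factor is a nonzero constant, only [L] remains. *)
  1: { apply (focal_conic_not_in_two_lines M g c P1 P2 P3 P4 P5 L L Hc Hnd HF).
    intros X HX. destruct (Hcase X HX) as [H|H]; [left; exact H|exfalso].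
    unfold s' in H. rewrite Hp, Hq in H. assert (Hz : N * c = 0) by lra.
    apply Rmult_integral in Hz. destruct Hz; [lra|tauto]. }
  all: assert (Hn : (p', q') <> (0, 0)) by (intros H; injection H; tauto);
    exact (focal_conic_not_in_two_lines M g c P1 P2 P3 P4 P5 L (Line p' q' s' Hn)
             Hc Hnd HF Hcase).
Qed.

Lemma focal_conic_axis (M g : point) (c : R) (P1 P2 P3 P4 P5 : point) :
  c <> 0 -> g <> (0, 0) -> NoDup [P1; P2; P3; P4; P5] ->
  passes_through5 (focal_conic M g c) P1 P2 P3 P4 P5 ->
  exists L, is_focal_axis (focal_conic M g c) L.
Proof.
  intros Hc Hg Hnd HF.
  assert (Hn : (- snd g, fst g) <> (0, 0)).
  { intros H; apply Hg; injection H; intros; apply point_eq; simpl; lra. }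
  set (L := Line (- snd g) (fst g) (cross g M) Hn).
  assert (HM : on_line L M) by (unfold on_line, line_eval; coords; ring).
  exists L. split.
  - intros X.
    pose proof (reflect_focal_eval M g c L X HM) as H. cbv zeta in H.
    replace (dot (line_normal L) g) with 0 in H
      by (unfold L, line_normal; coords; ring).
    assert (H' : focal_eval M g c X = focal_eval M g c (reflect L X)).
    { apply (Rmult_eq_reg_l (dot (line_normal L) (line_normal L) ^ 2)); [lra|].
      apply pow_nonzero, Rgt_not_eq, line_normal_pos. }
    unfold focal_conic; rewrite H'; tauto.
  - intros F HFoc.
    pose proof (focal_conic_foci_on_axis M g c P1 P2 P3 P4 P5 F Hc Hg Hnd HF HFoc) as H.
    unfold on_line. rewrite (line_eval_from L M F HM), <- H.
    unfold L, line_normal; coords; ring.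
Qed.

(** * Negative pedal curves of circles *)

Lemma circ_dot (K : point) (r t : R) :
  dot (psub (circ K r t) K) (psub (circ K r t) K) = r^2.
Proof.
  pose proof (sin2_cos2 t) as H. unfold Rsqr in H.
  transitivity (r^2 * (sin t * sin t + cos t * cos t)).
  - unfold circ; coords; ring.
  - rewrite H; ring.
Qed.

(** The tangent vector at [P] is [P - K] turned by a right angle, so the derivative
    condition says that [X + M - 2 P] is parallel to [P - K]. *)
Lemma neg_pedal_touch_equations (K M X : point) (r t : R) :
  neg_pedal_touch (circ K r) M t X ->
  let P := circ K r t in
  dot (psub X P) (psub P M) = 0 /\
  cross (psub P K) (psub (padd X M) (padd P P)) = 0.
Proof.
  intros (_ & Hdot & Hder) P. split; [exact Hdot|].
  unfold circ in Hder. apply is_derive_unique in Hder.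
  rewrite <- Hder. symmetry. apply is_derive_unique.
  unfold P, circ. coords.
  auto_derive; [exact I|ring].
Qed.

Lemma neg_pedal_touch_unique (K M X Y : point) (r t : R) :
  neg_pedal_touch (circ K r) M t X ->
  let P := circ K r t in
  dot (psub P K) (psub P M) <> 0 ->
  dot (psub Y P) (psub P M) = 0 ->
  cross (psub P K) (psub (padd Y M) (padd P P)) = 0 ->
  X = Y.
Proof.
  intros HX P Hdet HY1 HY2.
  apply neg_pedal_touch_equations in HX. fold P in HX.
  destruct HX as (HX1 & HX2).
  set (dx := fst X - fst Y). set (dy := snd X - snd Y).
  (* The linear form with coefficients [X - Y] vanishes at the normal vectors of
     both equations, which are independent. *)
  destruct (affine_form_zero dx dy 0 (0, 0) (psub P M)
      (- snd (psub P K), fst (psub P K))) as (H1 & H2 & _).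
  - intros H; apply Hdet; rewrite <- H; unfold dot, cross, psub; simpl; ring.
  - simpl; ring.
  - unfold dx, dy; clearbody P; coords; lra.
  - unfold dx, dy; clearbody P; coords; lra.
  - apply point_eq; unfold dx, dy in *; lra.
Qed.

(** When the pedal point is on the circle, the right angle at [P] is inscribed in
    it, so every perpendicular passes through the antipode of [M]. *)
Lemma neg_pedal_touch_antipode (K M X : point) (r t : R) :
  dot (psub M K) (psub M K) = r^2 -> neg_pedal_touch (circ K r) M t X ->
  X = psub (padd K K) M.
Proof.
  intros HM HT.
  pose proof (dot_psub_pos _ _ (not_eq_sym (proj1 HT))) as Hpos.
  pose proof (circ_dot K r t) as Hp.
  apply (neg_pedal_touch_unique _ _ _ _ _ _ HT);
    set (P := circ K r t) in *; clearbody P; coords; lra.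
Qed.

(** * The oblique frame of the triangle *)

Definition frame (V e1 e2 : point) (x y : R) : point :=
  (fst V + x * fst e1 + y * fst e2, snd V + x * snd e1 + y * snd e2).

Definition equilateral_frame (r : R) (e1 e2 : point) : Prop :=
  0 < r /\ dot e1 e1 = r^2 /\ dot e2 e2 = r^2 /\ dot e1 e2 = r^2 / 2.

Lemma equilateral_frame_swap (r : R) (e1 e2 : point) :
  equilateral_frame r e1 e2 -> equilateral_frame r e2 e1.
Proof.
  intros (Hr & H1 & H2 & H12). repeat split; auto. rewrite <- H12.
  unfold dot; ring.
Qed.

Lemma frame_swap (V e1 e2 : point) (x y : R) : frame V e1 e2 x y = frame V e2 e1 y x.
Proof. apply point_eq; simpl; ring. Qed.

Lemma equilateral_frame_cross (r : R) (e1 e2 : point) :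
  equilateral_frame r e1 e2 -> cross e1 e2 <> 0.
Proof.
  intros (Hr & H1 & H2 & H12) H.
  assert (H' : cross e1 e2 ^ 2 = dot e1 e1 * dot e2 e2 - dot e1 e2 ^ 2)
    by (unfold cross, dot; ring).
  rewrite H, H1, H2, H12 in H'.
  assert (0 < r^2) by (apply pow_lt; exact Hr). nra.
Qed.

Lemma frame_inj (r : R) (V e1 e2 : point) (x y x' y' : R) :
  equilateral_frame r e1 e2 -> frame V e1 e2 x y = frame V e1 e2 x' y' ->
  x = x' /\ y = y'.
Proof.
  intros He H. apply equilateral_frame_cross in He.
  injection H; intros Hy Hx. unfold cross in He.
  split; apply (Rmult_eq_reg_r (fst e1 * snd e2 - snd e1 * fst e2)); auto.
  - transitivity (((fst V + x * fst e1 + y * fst e2) - fst V) * snd e2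
                 - ((snd V + x * snd e1 + y * snd e2) - snd V) * fst e2); [ring|].
    rewrite Hx, Hy; ring.
  - transitivity (((snd V + x * snd e1 + y * snd e2) - snd V) * fst e1
                 - ((fst V + x * fst e1 + y * fst e2) - fst V) * snd e1); [ring|].
    rewrite Hx, Hy; ring.
Qed.

(** The inner product in a basis of two unit vectors at 60 degrees. *)
Definition oblique_dot (x y x' y' : R) : R := x * x' + y * y' + (x * y' + x' * y) / 2.

Lemma frame_dot (r : R) (e1 e2 : point) (x y x' y' : R) :
  equilateral_frame r e1 e2 ->
  dot (frame (0, 0) e1 e2 x y) (frame (0, 0) e1 e2 x' y') = r^2 * oblique_dot x y x' y'.
Proof.
  intros (Hr & H1 & H2 & H12).
  transitivity (x * x' * dot e1 e1 + y * y' * dot e2 e2 + (x * y' + x' * y) * dot e1 e2).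
  - unfold frame, dot; simpl; ring.
  - rewrite H1, H2, H12; unfold oblique_dot; field.
Qed.

(** Cramer's rule for the weights of [M]; its determinants are the sines of
    differences of angles, positive up to a common sign on an arc shorter than
    a half circle. *)
Lemma on_arc_coords (K A B M : point) (r t : R) :
  0 < r -> minor_arc K r A B t -> circ K r t = M -> M <> A -> M <> B ->
  exists m n : R, 0 < m /\ 0 < n /\ M = frame K (psub A K) (psub B K) m n.
Proof.
  intros Hr (a & b & Ha & Hb & Hab & Ht) HM HA HB.
  assert (Hta : t <> a) by congruence. assert (Htb : t <> b) by congruence.
  assert (Hdet : sin (b - a) <> 0 /\ 0 < sin (b - t) / sin (b - a) /\
                 0 < sin (t - a) / sin (b - a)).
  { destruct (Rle_or_lt a b) as [H|H].
    - rewrite Rmin_left, Rmax_right in Ht by lra.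
      rewrite Rabs_right in Hab by lra.
      assert (0 < sin (b - a)) by (apply sin_gt_0; lra).
      split; [lra|]. split; apply Rdiv_lt_0_compat; auto; apply sin_gt_0; lra.
    - rewrite Rmin_right, Rmax_left in Ht by lra.
      rewrite Rabs_left in Hab by lra.
      assert (H1 : 0 < sin (a - b)) by (apply sin_gt_0; lra).
      replace (b - a) with (- (a - b)) by ring.
      replace (b - t) with (- (t - b)) by ring.
      replace (t - a) with (- (a - t)) by ring.
      rewrite !sin_neg.
      split; [lra|].
      replace (- sin (t - b) / - sin (a - b)) with (sin (t - b) / sin (a - b)) by (field; lra).
      replace (- sin (a - t) / - sin (a - b)) with (sin (a - t) / sin (a - b)) by (field; lra).
      split; apply Rdiv_lt_0_compat; auto; apply sin_gt_0; lra. }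
  destruct Hdet as (Hd & Hm & Hn).
  exists (sin (b - t) / sin (b - a)), (sin (t - a) / sin (b - a)).
  split; [exact Hm|split; [exact Hn|]].
  rewrite <- HM, <- Ha, <- Hb. rewrite !sin_minus in *.
  apply point_eq; unfold frame, circ; coords; field; assumption.
Qed.

Lemma neg_pedal_touch_frame (r t : R) (e1 e2 K M X : point) (px py kx ky x y : R) :
  equilateral_frame r e1 e2 ->
  neg_pedal_touch (circ K r) M t X ->
  circ K r t = frame M e1 e2 px py -> K = frame M e1 e2 kx ky ->
  oblique_dot (px - kx) (py - ky) px py <> 0 ->
  oblique_dot (x - px) (y - py) px py = 0 ->
  (px - kx) * (y - 2 * py) - (py - ky) * (x - 2 * px) = 0 ->
  X = frame M e1 e2 x y.
Proof.
  intros He Ht HP HK Hdet H1 H2.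
  assert (Hr : r^2 <> 0) by (destruct He; apply pow_nonzero; lra).
  apply (neg_pedal_touch_unique _ _ _ _ _ _ Ht); rewrite HP; rewrite ?HK.
  - replace (dot _ _) with
      (dot (frame (0,0) e1 e2 (px - kx) (py - ky)) (frame (0,0) e1 e2 px py))
      by (unfold frame; coords; ring).
    rewrite (frame_dot r) by assumption.
    apply Rmult_integral_contrapositive; tauto.
  - replace (dot _ _) with
      (dot (frame (0,0) e1 e2 (x - px) (y - py)) (frame (0,0) e1 e2 px py))
      by (unfold frame; coords; ring).
    rewrite (frame_dot r) by assumption. rewrite H1; ring.
  - transitivity (((px - kx) * (y - 2 * py) - (py - ky) * (x - 2 * px)) * cross e1 e2).
    + unfold frame; coords; ring.
    + rewrite H2; ring.
Qed.

(** The displacement from [M] to [A1] is [2 n / (1 + m + n)] times the vector with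
    coordinates [(n, - (m + n))], which is [M - V3] turned by 120 degrees.  The ends [B1], [B2] of the other
    arc come from exchanging [e1] with [e2] and [m] with [n]. *)
Lemma elliptic_arc_ends (r : R) (e1 e2 V1 V2 V3 M A1 A2 : point) (t1 t3 m n : R) :
  equilateral_frame r e1 e2 ->
  0 < m -> 0 < n -> m^2 + m * n + n^2 = 1 ->
  V1 = frame M e1 e2 (1 - m) (- n) -> V2 = frame M e1 e2 (- m) (1 - n) ->
  V3 = frame M e1 e2 (- m) (- n) ->
  circ V2 r t1 = V1 -> neg_pedal_touch (circ V2 r) M t1 A1 ->
  circ V2 r t3 = V3 -> neg_pedal_touch (circ V2 r) M t3 A2 ->
  A1 = frame M e1 e2 (2 * n^2 / (1 + m + n)) (- (2 * n * (m + n)) / (1 + m + n)) /\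
  A2 = frame M e1 e2 (- 2 * m) (- 2 * n + 2 / (m + 2 * n)).
Proof.
  intros He Hm Hn Hmn E1 E2 E3 C1 T1 C3 T3.
  assert (Hm1 : m < 1) by nra.
  split.
  - apply (neg_pedal_touch_frame r t1 e1 e2 V2 M A1 (1 - m) (- n) (- m) (1 - n));
      auto; try congruence; unfold oblique_dot.
    + lra.
    + apply (Rmult_eq_reg_r (1 + m + n)); [|lra].
      transitivity ((m^2 + m * n + n^2 - 1) * (1 - m)); [field; lra|].
      rewrite Hmn; ring.
    + apply (Rmult_eq_reg_r (1 + m + n)); [|lra].
      transitivity ((m^2 + m * n + n^2 - 1) * 2); [field; lra|].
      rewrite Hmn; ring.
  - apply (neg_pedal_touch_frame r t3 e1 e2 V2 M A2 (- m) (- n) (- m) (1 - n));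
      auto; try congruence; unfold oblique_dot.
    + lra.
    + transitivity (m^2 + m * n + n^2 - 1); [field; lra|].
      rewrite Hmn; ring.
    + ring.
Qed.

(** * The conic of the five points *)

(** Up to sign, [d] is the distance to the focus in units of [r]. *)
Lemma focal_conic_frame (r : R) (e1 e2 M g : point) (p q k x y d : R) :
  equilateral_frame r e1 e2 ->
  dot g e1 = r * p -> dot g e2 = r * q ->
  oblique_dot x y x y = d^2 -> k + p * x + q * y = d ->
  focal_conic M g (r * k) (frame M e1 e2 x y).
Proof.
  intros He Hp Hq Hd Hk. unfold focal_conic, focal_eval.
  replace (psub (frame M e1 e2 x y) M) with (frame (0,0) e1 e2 x y)
    by (apply point_eq; unfold frame; coords; ring).
  rewrite (frame_dot r), Hd, <- Hk by assumption.
  replace (dot g (frame (0,0) e1 e2 x y)) with (x * dot g e1 + y * dot g e2)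
    by (unfold frame; coords; ring).
  rewrite Hp, Hq; ring.
Qed.

Lemma focal_conic_antipode (r : R) (e1 e2 M g : point) (m n : R) :
  equilateral_frame r e1 e2 -> m^2 + m * n + n^2 = 1 ->
  dot g e1 = r * (1 - 2 * m - n) -> dot g e2 = r * (1 - m - 2 * n) ->
  focal_conic M g (r * (2 * (m + n - 1))) (frame M e1 e2 (- 2 * m) (- 2 * n)).
Proof.
  intros He Hmn Hg1 Hg2.
  apply (focal_conic_frame r e1 e2 M g _ _ _ _ _ 2 He Hg1 Hg2); unfold oblique_dot; lra.
Qed.

Lemma focal_conic_arc_ends (r : R) (e1 e2 M g : point) (m n : R) :
  equilateral_frame r e1 e2 -> 0 < m -> 0 < n -> m^2 + m * n + n^2 = 1 ->
  dot g e1 = r * (1 - 2 * m - n) -> dot g e2 = r * (1 - m - 2 * n) ->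
  let C := focal_conic M g (r * (2 * (m + n - 1))) in
  C (frame M e1 e2 (2 * n^2 / (1 + m + n)) (- (2 * n * (m + n)) / (1 + m + n))) /\
  C (frame M e1 e2 (- 2 * m) (- 2 * n + 2 / (m + 2 * n))).
Proof.
  intros He Hm Hn Hmn Hg1 Hg2 C.
  set (N := m^2 + m * n + n^2) in Hmn.
  split;
    [ apply (focal_conic_frame r e1 e2 M g _ _ _ _ _ (2 * n / (1 + m + n)) He Hg1 Hg2)
    | apply (focal_conic_frame r e1 e2 M g _ _ _ _ _ (2 / (m + 2 * n)) He Hg1 Hg2) ];
    unfold oblique_dot.
  - transitivity ((2 * n / (1 + m + n))^2 * N); [unfold N; field; lra|].
    rewrite Hmn; ring.
  - transitivity (2 * n / (1 + m + n) + 2 * (N - 1) * (1 + n) / (1 + m + n)).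
    + unfold N; field; lra.
    + rewrite Hmn; field; lra.
  - transitivity ((2 / (m + 2 * n))^2 + 4 * (N - 1)); [unfold N; field; lra|].
    rewrite Hmn; ring.
  - transitivity (2 / (m + 2 * n) + 4 * (N - 1)); [unfold N; field; lra|].
    rewrite Hmn; ring.
Qed.

Lemma five_points_distinct (r : R) (e1 e2 M : point) (m n : R) :
  equilateral_frame r e1 e2 -> 0 < m -> 0 < n ->
  NoDup [ frame M e1 e2 (- 2 * m) (- 2 * n);
          frame M e1 e2 (2 * n^2 / (1 + m + n)) (- (2 * n * (m + n)) / (1 + m + n));
          frame M e1 e2 (- 2 * m) (- 2 * n + 2 / (m + 2 * n));
          frame M e1 e2 (- (2 * m * (n + m)) / (1 + n + m)) (2 * m^2 / (1 + n + m));
          frame M e1 e2 (- 2 * m + 2 / (n + 2 * m)) (- 2 * n) ].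
Proof.
  intros He Hm Hn.
  replace (1 + n + m) with (1 + m + n) by ring.
  set (k := 2 / (1 + m + n)). set (a := 2 / (m + 2 * n)). set (b := 2 / (n + 2 * m)).
  assert (Hk : 0 < k) by (apply Rdiv_lt_0_compat; lra).
  assert (Ha : 0 < a) by (apply Rdiv_lt_0_compat; lra).
  assert (Hb : 0 < b) by (apply Rdiv_lt_0_compat; lra).
  assert (Hk2 : k * (m + n) = 2 - k) by (unfold k; field; lra).
  replace (2 * n^2 / (1 + m + n)) with (k * (n * n)) by (unfold k; field; lra).
  replace (2 * m^2 / (1 + m + n)) with (k * (m * m)) by (unfold k; field; lra).
  replace (- (2 * n * (m + n)) / (1 + m + n)) with (- (n * (2 - k)))
    by (rewrite <- Hk2; unfold k; field; lra).
  replace (- (2 * m * (n + m)) / (1 + m + n)) with (- (m * (2 - k)))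
    by (rewrite <- Hk2; unfold k; field; lra).
  clearbody k a b.
  assert (Hkn : 0 < k * n) by (apply Rmult_lt_0_compat; assumption).
  assert (Hkm : 0 < k * m) by (apply Rmult_lt_0_compat; assumption).
  assert (Hkn2 : 0 < k * (n * n)) by (repeat apply Rmult_lt_0_compat; assumption).
  assert (Hkm2 : 0 < k * (m * m)) by (repeat apply Rmult_lt_0_compat; assumption).
  assert (Hlt : 0 < 2 - k) by (rewrite <- Hk2; apply Rmult_lt_0_compat; lra).
  assert (Hn2 : 0 < n * (2 - k)) by (apply Rmult_lt_0_compat; assumption).
  assert (Hm2 : 0 < m * (2 - k)) by (apply Rmult_lt_0_compat; assumption).
  repeat apply NoDup_cons; [..|apply NoDup_nil];
    simpl; intros H; repeat destruct H as [H|H]; try contradiction;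
    apply (frame_inj r _ _ _ _ _ _ _ He) in H; destruct H; lra.
Qed.

Theorem theorem1 :
  forall (r : R) (V1 V2 V3 O M P0 A1 A2 B1 B2 : point),
    equilateral r V1 V2 V3 ->
    is_circumcenter V1 V2 V3 O ->
    on_minor_arc V3 r V1 V2 M -> M <> V1 -> M <> V2 ->
    (forall X : point,
       neg_pedal_curve (circ V3 r) (minor_arc V3 r V1 V2) M X <-> X = P0) ->
    neg_pedal_image (circ V2 r) (minor_arc V2 r V1 V3) M V1 A1 ->
    neg_pedal_image (circ V2 r) (minor_arc V2 r V1 V3) M V3 A2 ->
    neg_pedal_image (circ V1 r) (minor_arc V1 r V2 V3) M V2 B1 ->
    neg_pedal_image (circ V1 r) (minor_arc V1 r V2 V3) M V3 B2 ->
    exists Cstar : point -> Prop,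
      is_conic Cstar /\
      passes_through5 Cstar P0 A1 A2 B1 B2 /\
      (forall S : point -> Prop,
         is_conic S -> passes_through5 S P0 A1 A2 B1 B2 ->
         forall X : point, S X <-> Cstar X) /\
      is_focus Cstar M /\
      (exists L : line, is_focal_axis Cstar L) /\
      (forall L : line, is_focal_axis Cstar L -> on_line L O).
Proof.
  intros r V1 V2 V3 O M P0 A1 A2 B1 B2 Htri HO (t & Harc & HMt) HM1 HM2 HP0
    (s1 & _ & C1 & T1) (s2 & _ & C2 & T2) (s3 & _ & C3 & T3) (s4 & _ & C4 & T4).
  destruct (proj2 (HP0 P0) eq_refl) as (t0 & _ & T0). clear HP0.
  set (e1 := psub V1 V3). set (e2 := psub V2 V3).
  assert (He : equilateral_frame r e1 e2).
  { destruct Htri as (Hr & H12 & H23 & H31).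
    pose proof (edist_sqr V1 V2) as D12. pose proof (edist_sqr V2 V3) as D23.
    pose proof (edist_sqr V3 V1) as D31.
    rewrite H12 in D12; rewrite H23 in D23; rewrite H31 in D31.
    unfold equilateral_frame, e1, e2; repeat split; coords; lra. }
  assert (Hr : 0 < r) by apply Htri.
  destruct (on_arc_coords V3 V1 V2 M r t Hr Harc HMt HM1 HM2) as (m & n & Hm & Hn & HM).
  fold e1 e2 in HM.
  assert (Hmn : m^2 + m * n + n^2 = 1).
  { apply (Rmult_eq_reg_l (r^2)); [|apply pow_nonzero; lra].
    transitivity (dot (frame (0,0) e1 e2 m n) (frame (0,0) e1 e2 m n)).
    - rewrite (frame_dot r) by exact He. unfold oblique_dot; field.
    - replace (frame (0,0) e1 e2 m n) with (psub (circ V3 r t) V3).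
      + rewrite circ_dot; ring.
      + rewrite HMt, HM. apply point_eq; unfold frame; coords; ring. }
  assert (Hmn1 : 1 < m + n) by nra.
  assert (EV1 : V1 = frame M e1 e2 (1 - m) (- n))
    by (rewrite HM; apply point_eq; unfold frame, e1, e2; coords; ring).
  assert (EV2 : V2 = frame M e1 e2 (- m) (1 - n))
    by (rewrite HM; apply point_eq; unfold frame, e1, e2; coords; ring).
  assert (EV3 : V3 = frame M e1 e2 (- m) (- n))
    by (rewrite HM; apply point_eq; unfold frame, e1, e2; coords; ring).
  destruct (elliptic_arc_ends r e1 e2 V1 V2 V3 M A1 A2 s1 s2 m n)
    as (EA1 & EA2); auto.
  destruct (elliptic_arc_ends r e2 e1 V2 V1 V3 M B1 B2 s3 s4 n m)
    as (EB1 & EB2); auto; try (rewrite frame_swap; assumption).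
  { apply equilateral_frame_swap; exact He. }
  { lra. }
  rewrite frame_swap in EB1, EB2.
  assert (EP0 : P0 = frame M e1 e2 (- 2 * m) (- 2 * n)).
  { transitivity (psub (padd V3 V3) M).
    2: { rewrite EV3; apply point_eq; unfold frame; coords; ring. }
    apply (neg_pedal_touch_antipode _ _ _ r t0); [|exact T0].
    rewrite <- HMt; apply circ_dot. }
  (* Equidistance of [O] from the vertices is used in the form
     [(O - V3) . e1 = (O - V3) . e2 = r^2 / 2], from which [g . e1] and [g . e2]
     follow. *)
  set (g := (2 / r * (fst O - fst M), 2 / r * (snd O - snd M)) : point).
  assert (Hg : dot g e1 = r * (1 - 2 * m - n) /\ dot g e2 = r * (1 - m - 2 * n)).
  { destruct HO as (HO1 & HO2).
    pose proof (edist_sqr O V1) as D1. pose proof (edist_sqr O V2) as D2.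
    pose proof (edist_sqr O V3) as D3. rewrite HO1 in D1. rewrite HO2 in D1, D2.
    destruct He as (_ & H1 & H2 & H12).
    assert (O1 : dot (psub O V3) e1 = r^2 / 2)
      by (rewrite <- H1; unfold e1 in *; coords; lra).
    assert (O2 : dot (psub O V3) e2 = r^2 / 2)
      by (rewrite <- H2; unfold e2 in *; coords; lra).
    split.
    - transitivity (2 / r * (dot (psub O V3) e1 - m * dot e1 e1 - n * dot e1 e2)).
      + unfold g; rewrite HM; unfold frame; coords; ring.
      + rewrite O1, H1, H12; field; lra.
    - transitivity (2 / r * (dot (psub O V3) e2 - m * dot e1 e2 - n * dot e2 e2)).
      + unfold g; rewrite HM; unfold frame; coords; ring.
      + rewrite O2, H2, H12; field; lra. }
  destruct Hg as (Hg1 & Hg2).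
  assert (Hg0 : g <> (0, 0)).
  { intros H. rewrite H in Hg1, Hg2. unfold dot in Hg1, Hg2; simpl in Hg1, Hg2. nra. }
  set (c := r * (2 * (m + n - 1))).
  assert (Hc : c <> 0) by (apply Rmult_integral_contrapositive; lra).
  assert (HF : passes_through5 (focal_conic M g c) P0 A1 A2 B1 B2).
  { destruct (focal_conic_arc_ends r e1 e2 M g m n) as (FA1 & FA2); auto.
    destruct (focal_conic_arc_ends r e2 e1 M g n m) as (FB1 & FB2); try lra.
    { apply equilateral_frame_swap; exact He. }
    rewrite frame_swap in FB1, FB2. replace (n + m - 1) with (m + n - 1) in FB1, FB2 by ring.
    rewrite EP0, EA1, EA2, EB1, EB2.
    split; [apply focal_conic_antipode; auto|].
    split; [exact FA1|split; [exact FA2|split; [exact FB1|exact FB2]]]. }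
  assert (Hnd : NoDup [P0; A1; A2; B1; B2]).
  { rewrite EP0, EA1, EA2, EB1, EB2. apply (five_points_distinct r); assumption. }
  exists (focal_conic M g c).
  split; [apply focal_conic_is_conic|].
  split; [exact HF|].
  split; [intros S; apply five_points_unique_conic; assumption|].
  split; [apply focal_conic_focus; assumption|].
  split; [apply (focal_conic_axis M g c P0 A1 A2 B1 B2); assumption|].
  intros L (Hsym & Hfoci).
  assert (HML : on_line L M) by (apply Hfoci, focal_conic_focus; assumption).
  assert (Hdir : dot (line_normal L) g = 0)
    by (apply (focal_axis_direction M g c P0 A1 A2 B1 B2); assumption).
  unfold on_line. rewrite (line_eval_from L M O HML).
  transitivity (r / 2 * dot (line_normal L) g).
  - unfold g; coords; field; lra.
  - rewrite Hdir; ring.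
Qed.
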